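(* Let $(\alpha_n)$ and $(\beta_n)$ be sequences of nonnegative real numbers and let $r$ be a rate of divergence for $\sum_{i=0}^\infty\alpha_i=\infty$. Let $\varepsilon>0$ and $g:\mathbb{N}\to\mathbb{N}$ be arbitrary. Suppose $N_1,N_2\in\mathbb{N}$ and $\theta>0$ are such that, with $N:=\max\{N_1,N_2\}$, $$\sum_{i=N_1}^{r(N+g(N),\varepsilon/4\theta)}\alpha_i\beta_i\leq\frac{\varepsilon^2}{8\theta}$$ and $$\beta_n-\beta_m\leq\theta\sum_{i=n}^{m-1}\alpha_i+\frac{\varepsilon}{4}\quad\text{for all } N_2\leq n<m\leq r\!\left(N+g(N),\frac{\varepsilon}{4\theta}\right).$$ Then $\beta_n\leq\varepsilon$ for all $n\in[N,N+g(N)]$.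
   Context: $\mathbb{Q}_+$ denotes the strictly positive rationals and $[a,a+b]:=\{a,a+1,\dots,a+b\}$ for natural numbers $a,b$. For a sequence $(b_n)$ of nonnegative reals with $\sum_{i=0}^\infty b_i=\infty$, a rate of divergence is a function $r:\mathbb{N}\times\mathbb{Q}_+\to\mathbb{N}$ such that $\sum_{i=n}^{r(n,x)}b_i\geq x$ for all $n\in\mathbb{N}$ and $x\in\mathbb{Q}_+$, and which is moreover monotone in its first argument: $m\leq n$ implies $r(m,x)\leq r(n,x)$. *)

(* Defs.v *)
From HB Require Import structures.
From mathcomp Require Import all_boot all_order all_algebra.
From mathcomp Require Import reals ereal interval_inference sequences.

Set Implicit Arguments.
Unset Strict Implicit.
Unset Printing Implicit Defensive.

Import Order.TTheory GRing.Theory Num.Theory.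

Local Open Scope ring_scope.

(* The strictly positive rationals are the library type {posnum rat}. The upper
   summation bound r(n, x) is inclusive, whence the successor. *)
Definition rate_of_divergence (R : realType) (b : nat -> R)
    (r : nat -> {posnum rat} -> nat) : Prop :=
  (forall (n : nat) (x : {posnum rat}),
     ratr x%:num <= \sum_(n <= i < (r n x).+1) b i)
  /\ (forall (m n : nat) (x : {posnum rat}), (m <= n)%N -> (r m x <= r n x)%N).

(* Main.v *)
(** Fix [n] in the window, put [M := r (N + g N) q] and let [m] be the first
    index in [n .. M] with [beta m <= eps / 2].  Before [m] the weights [beta i]
    exceed [eps / 2], so the bound on the sum of the [alpha i * beta i] yields
    [\sum_(n <= i < m) alpha i <= eps / (4 * theta)], and therefore
    [beta n <= eps / 2 + eps / 4 + eps / 4].  If there were no such [m], the sum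
    of the [alpha i] up to [M], which is at least [eps / (4 * theta)] by the rate
    of divergence, would make the weighted sum exceed [eps ^+ 2 / (8 * theta)]. *)

Require Import Defs.
From mathcomp Require Import all_boot all_order all_algebra.
From mathcomp Require Import reals ereal interval_inference sequences.
From mathcomp Require Import ring lra.

Import Order.TTheory GRing.Theory Num.Theory.

Local Open Scope ring_scope.

Lemma weighted_sum_ge {R : numDomainType} (a b : nat -> R) (c : R) (m n : nat) :
    (forall i, 0 <= a i) -> (forall i, (m <= i < n)%N -> c <= b i) ->
  c * (\sum_(m <= i < n) a i) <= \sum_(m <= i < n) a i * b i.
Proof.
move=> a_ge0 c_le; rewrite mulr_sumr; apply: ler_sum_nat => i Hi.
by rewrite mulrC ler_wpM2l ?a_ge0 ?c_le.
Qed.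

(** In case of equality the nonnegative terms [a j * (b j - c)] would sum to zero, hence all vanish;
    as [b j - c] is positive, every [a j] would be zero, against the positive sum. *)
Lemma weighted_sum_gt {R : numDomainType} (a b : nat -> R) (c : R) (m n : nat) :
    (forall i, 0 <= a i) -> (forall i, (m <= i < n)%N -> c < b i) ->
    0 < \sum_(m <= i < n) a i ->
  c * (\sum_(m <= i < n) a i) < \sum_(m <= i < n) a i * b i.
Proof.
move=> a_ge0 c_lt sum_gt0; rewrite lt_neqAle weighted_sum_ge ?andbT //; last first.
  by move=> i /c_lt/ltW.
apply/eqP=> eq_sum; move: sum_gt0; rewrite big_nat big1 ?ltxx // => i Hi.
have excess0 : \sum_(m <= j < n | (m <= j < n)%N) a j * (b j - c) = 0.
  rewrite -big_nat; under eq_bigr do rewrite mulrBr.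
  by rewrite sumrB -eq_sum -mulr_suml mulrC subrr.
have excess_ge0 j : (m <= j < n)%N -> 0 <= a j * (b j - c).
  by move=> /c_lt/ltW c_le; rewrite mulr_ge0 ?subr_ge0.
have /eqP := excess0; rewrite psumr_eq0 // => /allP/(_ i).
rewrite mem_index_iota Hi => /(_ isT) /=.
by rewrite mulf_eq0 subr_eq0 [b i == c]gt_eqF ?c_lt // orbF => /eqP.
Qed.

Lemma ler_sum_nat_subrange {R : numDomainType} (f : nat -> R) (m1 m2 n1 n2 : nat) :
    (forall i, 0 <= f i) -> (m1 <= m2)%N -> (n2 <= n1)%N ->
  \sum_(m2 <= i < n2) f i <= \sum_(m1 <= i < n1) f i.
Proof.
move=> f_ge0 le_m le_n; have [lt_mn|le_nm] := leqP m2 n2; last first.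
  by rewrite big_geq ?sumr_ge0 // ltnW.
rewrite (big_cat_nat le_m) /=; last exact: leq_trans le_n.
rewrite (big_cat_nat lt_mn le_n) /=.
by rewrite addrCA lerDl addr_ge0 ?sumr_ge0.
Qed.

Theorem theorem3p9 (R : realType) (alpha beta : nat -> R)
    (alpha_ge0 : forall n, 0 <= alpha n)
    (beta_ge0 : forall n, 0 <= beta n)
    (alpha_div : (\sum_(0 <= i <oo) (alpha i)%:E = +oo)%E)
    (r : nat -> {posnum rat} -> nat)
    (r_rate : rate_of_divergence alpha r)
    (eps : R) (eps_gt0 : 0 < eps)
    (g : nat -> nat)
    (N1 N2 : nat) (theta : R) (theta_gt0 : 0 < theta)
    (q : {posnum rat}) (q_eq : ratr q%:num = eps / (4 * theta))
    (N : nat) (N_eq : N = maxn N1 N2)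
    (sum_le : \sum_(N1 <= i < (r (N + g N)%N q).+1) alpha i * beta i
                <= eps ^+ 2 / (8 * theta))
    (beta_sub : forall n m : nat,
       (N2 <= n)%N -> (n < m)%N -> (m <= r (N + g N)%N q)%N ->
       beta n - beta m <= theta * (\sum_(n <= i < m) alpha i) + eps / 4) :
  forall n : nat, (N <= n <= N + g N)%N -> beta n <= eps.
Proof.
move=> n /andP[le_Nn le_n]; have [r_div r_mono] := r_rate.
set M := r (N + g N)%N q in sum_le beta_sub *.
have /andP[le_N1 le_N2] : (N1 <= n)%N && (N2 <= n)%N by rewrite -geq_max -N_eq.
(* Monotonicity of [r] carries the divergence bound from each [n] in the window to the common end
   [M]. *)
have le_rM : (r n q <= M)%N by exact: r_mono.
have ab_ge0 i : 0 <= alpha i * beta i by rewrite mulr_ge0.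
have sum_ge : eps / (4 * theta) <= \sum_(n <= i < M.+1) alpha i.
  by rewrite -q_eq (le_trans (r_div n q)) // ler_sum_nat_subrange.
have q_gt0 : 0 < eps / (4 * theta) by rewrite divr_gt0 // mulr_gt0.
have eps2_gt0 : 0 < eps / 2 by rewrite divr_gt0.
(* The bound factors as the threshold for [beta] times the divergence target, so cancelling
   [eps / 2] leaves a bound on the plain sum of [alpha]. *)
have bound_eq : eps ^+ 2 / (8 * theta) = eps / 2 * (eps / (4 * theta)).
  by field; rewrite gt_eqF.
have sum_le_q m : (m <= M.+1)%N ->
    \sum_(n <= i < m) alpha i * beta i <= eps / 2 * (eps / (4 * theta)).
  by move=> le_mM; rewrite -bound_eq (le_trans _ sum_le) // ler_sum_nat_subrange.
have small_exists : exists m, (n <= m < M.+1)%N && (beta m <= eps / 2).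
  case: (boolP (has (fun i => beta i <= eps / 2) (index_iota n M.+1))).
    by case/hasP=> m; rewrite mem_index_iota => Hm le_m; exists m; rewrite Hm.
  move=> /hasPn no_small; exfalso.
  have beta_gt i : (n <= i < M.+1)%N -> eps / 2 < beta i.
    by move=> Hi; rewrite ltNge no_small // mem_index_iota.
  (* Strictness is essential: [sum_le_q] and [sum_ge] meet at the same value. *)
  have lt_sum := weighted_sum_gt alpha beta (eps / 2) n M.+1 alpha_ge0 beta_gt
    (lt_le_trans q_gt0 sum_ge).
  have := lt_le_trans lt_sum (sum_le_q _ (leqnn _)).
  by rewrite ltr_pM2l // ltNge sum_ge.
case: (ex_minnP small_exists) => m /andP[/andP[le_nm lt_mM] beta_m] m_min.
(* [beta_sub] needs [n < m]; if [m = n], the choice of [m] already bounds [beta n]. *)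
have [lt_nm|le_mn] := ltnP n m; last first.
  have -> : n = m by apply/eqP; rewrite eqn_leq le_nm.
  by apply: le_trans beta_m _; lra.
have beta_ge i : (n <= i < m)%N -> eps / 2 <= beta i.
  move=> /andP[le_ni lt_im]; rewrite leNgt; apply/negP => /ltW small_i.
  have := m_min i; rewrite le_ni (ltn_trans lt_im lt_mM) small_i => /(_ isT).
  by rewrite leqNgt lt_im.
have := le_trans (weighted_sum_ge alpha beta (eps / 2) n m alpha_ge0 beta_ge)
  (sum_le_q m (ltnW lt_mM)).
rewrite ler_pM2l // => sum_m.
have theta_sum : theta * (\sum_(n <= i < m) alpha i) <= eps / 4.
  have -> : eps / 4 = theta * (eps / (4 * theta)) by field; rewrite gt_eqF.
  by rewrite ler_pM2l.
(* [m < M.+1] is convertible to the required [m <= M]. *)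
have := beta_sub n m le_N2 lt_nm lt_mM.
lra.
Qed.
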